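(* Let $p,q$ be primes with $q$ odd and $q\mid p-1$, let $\ell>1$ be a divisor of $p-1$, and let $1\le i\le q-1$. If $q$ divides $\ell$, then $\Gamma(pq,\ell,i)\cong\Gamma(\mathbb{Z}_p\times\mathbb{Z}_q,\hat H,(1,1))$, where $\hat H=H\!\left(\frac{q-1}{2},\frac{p-1}{\ell},d\right)$ and $$d=\begin{cases}0&\text{if }\ell\text{ is even},\\ \frac{p-1}{2\ell}&\text{if }\ell\text{ is odd}.\end{cases}$$ In particular $\Gamma(pq,\ell,i)$ is independent of $i$ up to isomorphism.
   Context: For a group $G$ and an inverse-closed subset $S\subseteq G\setminus\{1\}$, $\mathrm{Cay}(G,S)$ is the graph with vertex set $G$ and edges $\{x,y\}$ with $yx^{-1}\in S$. For $H\leqslant\mathrm{Aut}(G)$ and $g\in G\setminus\{1\}$, $\Gamma(G,H,g):=\mathrm{Cay}(G,g^H\cup g^{-H})$, where $g^H$ is the $H$-orbit of $g$ and $g^{-H}=(g^{-1})^H$. Let $A=\mathrm{AGL}(1,p)$ be the group of maps $x\mapsto xa+b$ of $\mathbb{Z}_p$ ($a\ne0$), with maps composed left to right. Let $m$ be a fixed primitive element of $\mathbb{Z}_p$, write $m$ also for the map $x\mapsto xm$, and let $t:x\mapsto x+1$, so $m^{-1}tm=t^m$. Put $z=m^{(p-1)/q}$, $G_{pq}=\langle z,t\rangle\leqslant A$. Subgroups of $A$ act on $G_{pq}$ by conjugation. For a divisor $\ell>1$ of $p-1$, $H_{(\ell,1)}=\langle m^{(p-1)/\ell}t\rangle$ and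 $\Gamma(pq,\ell,i):=\Gamma(G_{pq},H_{(\ell,1)},z^i)$. Let $x,y$ be primitive elements (generators) of $\mathbb{Z}_p^*,\mathbb{Z}_q^*$. For integers $d_2,d_1,d$ with $d_2>0$, $d_2\mid q-1$, $d_1\mid p-1$, $0\le d<d_1$, $d_1d_2\mid d(q-1)$, define $H(d_2,d_1,d):=\langle(x^d,y^{d_2}),(x^{d_1},1)\rangle\leqslant\mathbb{Z}_p^*\times\mathbb{Z}_q^*=\mathrm{Aut}(\mathbb{Z}_p\times\mathbb{Z}_q)$, acting by componentwise multiplication. *)

(* Defs.v *)
From mathcomp Require Import all_boot all_order all_algebra all_fingroup.
From mathcomp Require Import all_solvable.

Set Implicit Arguments.
Unset Strict Implicit.
Unset Printing Implicit Defensive.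

Import GroupScope.

Definition graph_iso (V W : finType) (e : rel V) (f : rel W) : Prop :=
  exists2 h : V -> W, bijective h & forall x y : V, f (h x) (h y) = e x y.

Section Cayley.

Variables (gT : finGroupType) (G : {group gT}).

(* A Cayley graph is given by its adjacency relation on the elements of G;
   it is a simple graph as soon as S = S^-1 and 1 \notin S. *)
Definition cay (S : {set gT}) : rel (subg_of G) :=
  fun x y => sgval y * (sgval x)^-1 \in S.

Lemma cay_sym (S : {set gT}) : S^-1 = S -> symmetric (cay S).
Proof. by move=> SV x y; rewrite /cay -[in LHS]SV inE invMg invgK. Qed.

Lemma cay_irr (S : {set gT}) : 1 \notin S -> irreflexive (cay S).
Proof. by move=> S1 x; rewrite /cay mulgV (negbTE S1). Qed.

(* H is meant to be a subgroup of Aut G, acting on G by evaluation. *)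
Definition gamma_set (H : {set {perm gT}}) (g : gT) : {set gT} :=
  orbit 'P H g :|: orbit 'P H g^-1.

Definition gamma (H : {set {perm gT}}) (g : gT) : rel (subg_of G) :=
  cay (gamma_set H g).

Lemma gamma_set_sub (H : {set {perm gT}}) (g : gT) :
  H \subset Aut G -> g \in G^# -> gamma_set H g \subset G^#.
Proof.
move=> sHA; rewrite 2!inE => /andP[g1 Gg].
have stab a h : a \in Aut G -> h \in G -> h != 1 -> a h \in G^#.
  move=> Aa Gh h1; rewrite !inE Aut_closed // andbT.
  have a1 : a 1 = 1 by rewrite -(autmE Aa) morph1.
  by apply: contraNneq h1 => ah1; apply/eqP/(@perm_inj _ a); rewrite a1.
apply/subsetP=> y /setUP[] /imsetP[a /(subsetP sHA) Aa ->]; apply: stab => //.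
  by rewrite groupV.
by rewrite invg_eq1.
Qed.

Lemma gamma_set_inv (H : {set {perm gT}}) (g : gT) :
  H \subset Aut G -> g \in G -> (gamma_set H g)^-1 = gamma_set H g.
Proof.
move=> sHA Gg.
have sub h : h \in G -> (orbit 'P H h)^-1 \subset orbit 'P H h^-1.
  move=> Gh; apply/subsetP=> y; rewrite inE => /imsetP[a Ha Dy].
  apply/imsetP; exists a => //; rewrite -[y]invgK Dy /= /aperm.
  have Aa := subsetP sHA a Ha.
  by rewrite -!(autmE Aa) morphV.
have eqo h : h \in G -> (orbit 'P H h)^-1 = orbit 'P H h^-1.
  move=> Gh; apply/eqP; rewrite eqEsubset sub //=.
  by rewrite -invSg invgK -{2}[h]invgK sub ?groupV.
by rewrite /gamma_set invUg eqo // eqo ?groupV // invgK setUC.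
Qed.

Lemma gamma_sym (H : {set {perm gT}}) (g : gT) :
  H \subset Aut G -> g \in G^# -> symmetric (gamma H g).
Proof.
by move=> sHA /setD1P[_ Gg]; apply: cay_sym; apply: gamma_set_inv.
Qed.

Lemma gamma_irr (H : {set {perm gT}}) (g : gT) :
  H \subset Aut G -> g \in G^# -> irreflexive (gamma H g).
Proof.
move=> sHA Gg; apply: cay_irr.
by apply/negP=> /(subsetP (gamma_set_sub sHA Gg)); rewrite !inE eqxx.
Qed.

End Cayley.

(* Subgroups of AGL(1,p) are permutation groups on 'F_p; the product of
   {perm _} is composition from left to right. *)
Section Affine.

Variable p : nat.

Lemma aff_inj (a : {unit 'F_p}) (b : 'F_p) :
  injective (fun x : 'F_p => x * val a + b)%R.
Proof. by move=> x y /GRing.addIr /(GRing.mulIr (valP a)). Qed.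

Definition aff (a : {unit 'F_p}) (b : 'F_p) : {perm 'F_p} := perm (@aff_inj a b).

Definition AGL1 : {set {perm 'F_p}} :=
  [set aff ab.1 ab.2 | ab : {unit 'F_p} * 'F_p].

Lemma affE (a : {unit 'F_p}) (b x : 'F_p) : aff a b x = (x * val a + b)%R.
Proof. exact: permE. Qed.

Lemma affM (a c : {unit 'F_p}) (b d : 'F_p) :
  aff a b * aff c d = aff (a * c) (b * val c + d)%R.
Proof.
by apply/permP=> x; rewrite permM !affE GRing.mulrDl -GRing.mulrA GRing.addrA.
Qed.

Lemma AGL1_group_set : group_set AGL1.
Proof.
apply/group_setP; split.
  apply/imsetP; exists (1, 0%R) => //.
  by apply/permP=> x; rewrite perm1 affE /= GRing.mulr1 GRing.addr0.
move=> _ _ /imsetP[[a b] _ ->] /imsetP[[c d] _ ->]; rewrite affM.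
by apply/imsetP; exists (a * c, (b * val c + d)%R).
Qed.
Canonical AGL1_group := Group AGL1_group_set.

Definition mulp (m : {unit 'F_p}) : {perm 'F_p} := aff m 0%R.

Definition tr : {perm 'F_p} := aff 1 1%R.

Lemma trX (n : nat) : tr ^+ n = aff 1 n%:R%R.
Proof.
elim: n => [|n IHn]; last first.
  by rewrite expgSr IHn affM mulg1 /= GRing.mulr1 -GRing.natr1.
by apply/permP=> x; rewrite perm1 affE /= GRing.mulr1 GRing.addr0.
Qed.

Lemma tr_mulp (m : {unit 'F_p}) : tr ^ mulp m = tr ^+ val m.
Proof.
apply: (mulgI (mulp m)); rewrite -conjgC trX /mulp /tr !affM mul1g mulg1.
congr aff; rewrite /= GRing.mul1r GRing.mul0r GRing.add0r GRing.addr0.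
by rewrite Zp_nat valZpK.
Qed.

Definition zpq (q : nat) (m : {unit 'F_p}) : {perm 'F_p} :=
  mulp m ^+ (p.-1 %/ q).

Definition Gpq (q : nat) (m : {unit 'F_p}) : {group {perm 'F_p}} :=
  <<[set zpq q m; tr]>>%G.

Definition Hl1 (m : {unit 'F_p}) (l : nat) : {group {perm 'F_p}} :=
  <[mulp m ^+ (p.-1 %/ l) * tr]>%G.

Lemma mulp_AGL1 (m : {unit 'F_p}) : mulp m \in AGL1.
Proof. by apply/imsetP; exists (m, 0%R). Qed.

Lemma tr_AGL1 : tr \in AGL1.
Proof. by apply/imsetP; exists (1, 1%R). Qed.

Lemma Gpq_AGL1 (q : nat) (m : {unit 'F_p}) : Gpq q m \subset AGL1.
Proof. by rewrite gen_subG subUset !sub1set groupX ?mulp_AGL1 ?tr_AGL1. Qed.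

Lemma Hl1_AGL1 (m : {unit 'F_p}) (l : nat) : Hl1 m l \subset AGL1.
Proof. by rewrite cycle_subG groupM ?groupX ?mulp_AGL1 ?tr_AGL1. Qed.

Lemma Hl1_norm (q : nat) (m : {unit 'F_p}) (l : nat) : Hl1 m l \subset 'N(Gpq q m).
Proof.
have Gz : zpq q m \in Gpq q m by rewrite mem_gen // !inE eqxx.
have Gt : tr \in Gpq q m by rewrite mem_gen // !inE eqxx orbT.
rewrite cycle_subG groupM //; last exact: (subsetP (normG _)).
rewrite groupX // inE -genJ gen_subG; apply/subsetP=> u /imsetP[v].
rewrite !inE => /orP[]/eqP-> ->; last by rewrite tr_mulp groupX.
by rewrite conjXg conjgE mulKg.
Qed.

(* conj_aut G @* H is the group of automorphisms of G induced by conjugation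
   by the elements of 'N_H(G); by Hl1_norm this is all of H here. *)
Definition Gamma_pq (q : nat) (m : {unit 'F_p}) (l i : nat) :
    rel (subg_of (Gpq q m)) :=
  gamma (G := Gpq q m) (conj_aut (Gpq q m) @* Hl1 m l) (zpq q m ^+ i).

End Affine.

Arguments Gamma_pq [p] q m l i.

(* 'F_p * 'F_q is the additive group Z_p x Z_q, and {unit 'F_p} * {unit 'F_q}
   the direct product of the multiplicative groups. *)
Section Product.

Variables p q : nat.

Lemma scale_inj (u : {unit 'F_p} * {unit 'F_q}) :
  injective (fun w : 'F_p * 'F_q => (w.1 * val u.1, w.2 * val u.2)%R).
Proof.
move=> [a b] [c d] E; congr pair.
  exact: (GRing.mulIr (valP u.1) (congr1 fst E)).
exact: (GRing.mulIr (valP u.2) (congr1 snd E)).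
Qed.

Definition scale (u : {unit 'F_p} * {unit 'F_q}) : {perm ('F_p * 'F_q)} :=
  perm (@scale_inj u).

Lemma scaleM : {morph scale : u v / u * v}.
Proof. by move=> u v; apply/permP=> w; rewrite permM !permE /= !GRing.mulrA. Qed.

Lemma scale_injective : injective scale.
Proof.
move=> [a b] [c d] /permP/(_ (1, 1)%R); rewrite !permE /= !GRing.mul1r.
by case=> /val_inj-> /val_inj->.
Qed.

Lemma scale_Aut (u : {unit 'F_p} * {unit 'F_q}) :
  scale u \in Aut [set: 'F_p * 'F_q].
Proof.
rewrite inE; apply/andP; split; first by apply/subsetP=> w; rewrite inE.
by apply/morphicP=> v w _ _; rewrite !permE /=; congr pair; apply: GRing.mulrDl.
Qed.

Definition Hd (x : {unit 'F_p}) (y : {unit 'F_q}) (d2 d1 d : nat) :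
    {group {unit 'F_p} * {unit 'F_q}} :=
  <<[set (x ^+ d, y ^+ d2); (x ^+ d1, 1%g)]>>%G.

Definition Gamma_prod (x : {unit 'F_p}) (y : {unit 'F_q}) (d2 d1 d : nat) :
    rel (subg_of [set: 'F_p * 'F_q]%G) :=
  gamma (G := [set: 'F_p * 'F_q]%G) (scale @: Hd x y d2 d1 d) (1, 1)%R.

End Product.

(* Main.v *)
Require Import Defs.
From mathcomp Require Import all_boot all_order all_algebra all_fingroup.
From mathcomp Require Import all_solvable.
From mathcomp Require Import ring.

Set Implicit Arguments.
Unset Strict Implicit.
Unset Printing Implicit Defensive.

Import GroupScope.

(** Put mu = m^((p-1)/l), of order l, omega = z^i, of order q, and let c be the
    fixed point of the generator of H_(l,1). In the coordinate u = x - c that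
    generator is u |-> u mu, so conjugation by H_(l,1) multiplies translation
    parts by powers of mu, and (b, k) |-> (u |-> u omega^k + lam b), with
    lam = c (omega - 1) the translation part of z^i, is a bijection from
    Z_p x Z_q to G_pq. As q divides l, omega is a power of mu, so
    this bijection carries adjacency to the relation that the difference lies in
    the union of <mu> x {1} and its opposite. The connection set of the
    abelian Cayley graph is the same, because y^((q-1)/2) = -1 and - x^d lies
    in <mu> = {u | u^l = 1}. *)

(** * Graph isomorphisms and subgroups of cyclic groups *)

Lemma graph_iso_sym (V W : finType) (e : rel V) (f : rel W) :
  graph_iso e f -> graph_iso f e.
Proof.
case=> h [k hK kK] hE; exists k; first by exists h.
by move=> x y; rewrite -hE !kK.
Qed.

Lemma graph_iso_trans (U V W : finType) (d : rel U) (e : rel V) (f : rel W) :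
  graph_iso d e -> graph_iso e f -> graph_iso d f.
Proof.
move=> [h hbij hE] [k kbij kE]; exists (k \o h); first exact: bij_comp.
by move=> x y; rewrite /= kE.
Qed.

(** A cyclic group has a single subgroup of order [l]. Describing it by an equation free of [x] lets
    the two primitive elements [m] and [x] be compared. *)
Lemma mem_cycle_generator_dvd (gT : finGroupType) (G : {group gT}) (x u : gT)
    (l : nat) :
    generator G x -> l %| #|G| -> u \in G ->
  (u \in <[x ^+ (#|G| %/ l)]>) = (u ^+ l == 1).
Proof.
move=> /eqP defG l_dvd Gu; have ox : #[x] = #|G| by rewrite /order -defG.
apply/idP/eqP => [/cycleP[k ->]|].
  by rewrite -!expgM mulnCA divnK // mulnC expgM -ox expg_order expg1n.
have /cycleP[k ->] : u \in <[x]> by rewrite -defG.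
move/eqP; rewrite -expgM -order_dvdn ox -{1}(divnK l_dvd).
rewrite dvdn_pmul2r ?(dvdn_gt0 (cardG_gt0 G)) // => /dvdnP[j ->].
by rewrite mulnC expgM mem_cycle.
Qed.

Lemma card_unit_Fp (p : nat) : prime p -> #|[set: {unit 'F_p}]| = p.-1.
Proof.
by move=> p_pr; rewrite card_units_Zp ?pdiv_gt0 // pdiv_id ?totient_prime.
Qed.

(** * The unit -1 of a finite field *)

Section NegOne.

Variable F : finFieldType.

Definition unitN1 : {unit F} := FinRing.unit F (GRing.unitrN1 F).

Lemma unitN1_sqr : unitN1 ^+ 2 = 1.
Proof. by apply: val_inj; rewrite /= GRing.mulrN1 GRing.opprK. Qed.

(** The half power squares to 1 but differs from 1 by the order of [x], and a field has no square
    roots of 1 besides 1 and -1. *)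
Lemma generator_expg_half (x : {unit F}) :
    generator [set: {unit F}] x -> ~~ odd #|[set: {unit F}]| ->
  x ^+ (#|[set: {unit F}]| %/ 2) = unitN1.
Proof.
move=> /eqP defG n_even; have ox : #[x] = #|[set: {unit F}]|.
  by rewrite /order -defG.
set n := #|_| in n_even ox *; have n_gt0 : 0 < n by rewrite -ox order_gt0.
have n2 : (n %/ 2 * 2 = n)%N by rewrite divnK // dvdn2.
have u1 : x ^+ (n %/ 2) != 1.
  have n2_gt0 : 0 < n %/ 2 by move: n_gt0; rewrite -{1}n2 muln_gt0 andbT.
  by rewrite -order_dvdn ox gtnNdvd // ltn_Pdiv.
set u := x ^+ _ in u1 *; have : (val u ^+ 2 == 1)%R.
  by rewrite -FinRing.val_unitX -expgM n2 -ox expg_order.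
rewrite GRing.sqrf_eq1 => /orP[] /eqP uE; last exact: val_inj.
by case/eqP: u1; apply: val_inj.
Qed.

End NegOne.

(* aff_at a b is the map u |-> u a + b in the coordinate u = x - c. *)
Section AffineAt.

Variables (p : nat) (c : 'F_p).

Definition aff_at (a : {unit 'F_p}) (b : 'F_p) : {perm 'F_p} :=
  aff a (c * (1 - val a) + b)%R.

Lemma affE_at (a : {unit 'F_p}) (b : 'F_p) :
  aff a b = aff_at a (b - c * (1 - val a))%R.
Proof. by congr aff; ring. Qed.

Lemma aff_inj2 (a a' : {unit 'F_p}) (b b' : 'F_p) :
  aff a b = aff a' b' -> a = a' /\ b = b'.
Proof.
move=> E; have Eb : b = b'.
  by move/permP/(_ 0%R): E; rewrite !affE !GRing.mul0r !GRing.add0r.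
split=> //; apply: val_inj.
by move/permP/(_ 1%R): E; rewrite !affE Eb !GRing.mul1r => /GRing.addIr.
Qed.

Lemma aff_at_inj (a a' : {unit 'F_p}) (b b' : 'F_p) :
  aff_at a b = aff_at a' b' -> a = a' /\ b = b'.
Proof. by case/aff_inj2=> -> /GRing.addrI. Qed.

Lemma aff_atM (a a' : {unit 'F_p}) (b b' : 'F_p) :
  aff_at a b * aff_at a' b' = aff_at (a * a') (b * val a' + b')%R.
Proof. by rewrite affM; congr aff; rewrite FinRing.val_unitM; ring. Qed.

Lemma aff_at1 : aff_at 1 0%R = 1.
Proof.
by apply/permP=> x; rewrite affE perm1 /=
  GRing.subrr GRing.mulr0 !GRing.addr0 GRing.mulr1.
Qed.

Lemma aff_atV (a : {unit 'F_p}) (b : 'F_p) :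
  (aff_at a b)^-1 = aff_at a^-1 (- b * val (a^-1)%g)%R.
Proof.
apply/eqP; rewrite eq_invg_mul aff_atM mulgV.
by rewrite GRing.mulNr GRing.subrr aff_at1.
Qed.

Lemma aff_at0X (n : {unit 'F_p}) (k : nat) :
  aff_at n 0%R ^+ k = aff_at (n ^+ k) 0%R.
Proof.
elim: k => [|k IHk]; first by rewrite aff_at1.
by rewrite !expgS IHk aff_atM GRing.mul0r GRing.addr0.
Qed.

Lemma aff_atJ (a n : {unit 'F_p}) (b : 'F_p) :
  aff_at a b ^ aff_at n 0%R = aff_at a (b * val n)%R.
Proof.
rewrite conjgE aff_atV !aff_atM GRing.oppr0 GRing.mul0r GRing.mul0r.
by rewrite GRing.add0r GRing.addr0 unit_Zp_mulgC mulgK.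
Qed.

End AffineAt.

(** * The connection set of the abelian Cayley graph *)

Section Sets.

Variables (p q : nat) (M : {group {unit 'F_p}}).

(** Since -1 squares to 1, the union of M x {1} and (-M) x {-1} is a group, and it contains both
    generators of [Hd]. *)
Lemma mem_Hd_sign (x : {unit 'F_p}) (y : {unit 'F_q}) (d2 d1 d : nat)
    (v : {unit 'F_p} * {unit 'F_q}) :
    x ^+ d1 \in M -> unitN1 _ * x ^+ d \in M -> y ^+ d2 = unitN1 _ ->
    v \in Hd x y d2 d1 d ->
  exists2 u, u \in M & v = (u, 1) \/ v = (unitN1 _ * u, unitN1 _).
Proof.
move=> Mx1 Mx yN1 Hv.
(* Membership of [w.1] in -M is written as membership of its opposite in M. *)
pose K := [set w : {unit 'F_p} * {unit 'F_q} |
  (w.1 \in M) && (w.2 == 1) || (unitN1 _ * w.1 \in M) && (w.2 == unitN1 _)].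
have N1K (F : finFieldType) (u : {unit F}) : unitN1 F * (unitN1 F * u) = u.
  by rewrite mulgA -expg2 unitN1_sqr mul1g.
have gK : group_set K.
  apply/group_setP; split=> [|[a b] [a' b']]; first by rewrite inE group1 eqxx.
  rewrite !inE /= => /orP[] /andP[Ma /eqP->] /orP[] /andP[Ma' /eqP->].
  - by rewrite groupM // mulg1 eqxx.
  - by rewrite mul1g eqxx andbT mulgA [_ * a]unit_Zp_mulgC -mulgA
      (groupM Ma Ma') orbT.
  - by rewrite mulg1 eqxx andbT mulgA (groupM Ma Ma') orbT.
  apply/orP; left; rewrite -expg2 unitN1_sqr eqxx andbT.
  have := groupM Ma Ma'.
  by rewrite [_ * a]unit_Zp_mulgC -mulgA N1K.
have /subsetP/(_ v Hv) : Hd x y d2 d1 d \subset Group gK.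
  rewrite gen_subG; apply/subsetP=> w /set2P[]->; rewrite inE /=.
    by rewrite Mx yN1 eqxx orbT.
  by rewrite Mx1 eqxx.
rewrite inE; case: v {Hv} => a b /= /orP[] /andP[Ma /eqP->].
  by exists a => //; left.
by exists (unitN1 _ * a) => //; right; rewrite N1K.
Qed.

(** One inclusion is [mem_Hd_sign]. For the other, the elements (u, 1) of [Hd] suffice: applied to
    (1, 1) and to (-1, -1) they give the two halves. *)
Lemma mem_gamma_prod (x : {unit 'F_p}) (y : {unit 'F_q}) (d2 d1 d : nat)
    (w : 'F_p * 'F_q) :
    <[x ^+ d1]> = M -> unitN1 _ * x ^+ d \in M -> y ^+ d2 = unitN1 _ ->
  reflect (exists2 u, u \in M & w = (val u, 1)%R \/ w = (- val u, - 1)%R)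
    (w \in gamma_set (@scale p q @: Hd x y d2 d1 d) (1, 1)%R).
Proof.
move=> defM Mx yN1.
have scaleE (v : {unit 'F_p} * {unit 'F_q}) (a : 'F_p) (b : 'F_q) :
  'P%act (a, b) (scale v) = (a * val v.1, b * val v.2)%R.
  by rewrite /= /aperm permE.
have MHd u : u \in M -> (u, 1) \in Hd x y d2 d1 d.
  rewrite -defM => /cycleP[k ->].
  have -> : (x ^+ d1 ^+ k, 1) = (x ^+ d1, 1 : {unit 'F_q}) ^+ k.
    by elim: k => // k IHk; rewrite !expgS -IHk; congr pair; rewrite mulg1.
  by rewrite groupX // mem_gen // !inE eqxx orbT.
have xM : x ^+ d1 \in M by rewrite -defM cycle_id.
apply: (iffP setUP) => [[] /imsetP[_ /imsetP[v Hv ->] ->]|[u Mu []->]].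
- have [u Mu []->] := mem_Hd_sign xM Mx yN1 Hv; exists u => //.
    by left; rewrite scaleE /= !GRing.mul1r.
  by right; rewrite scaleE /= !GRing.mul1r GRing.mulN1r.
- have [u Mu []->] := mem_Hd_sign xM Mx yN1 Hv; exists u => //.
    by right; rewrite scaleE /= !GRing.mulN1r.
  by left; rewrite scaleE /= !GRing.mulN1r !GRing.opprK.
- left; apply/imsetP; exists (scale (u, 1)); first by rewrite imset_f ?MHd.
  by rewrite scaleE /= !GRing.mul1r.
right; apply/imsetP; exists (scale (u, 1)); first by rewrite imset_f ?MHd.
by rewrite scaleE /= !GRing.mulN1r.
Qed.

End Sets.

(** * The group [Gpq] and its orbits under conjugation by [Hl1] *)

Section AffineGroup.

Variables (p q : nat) (m : {unit 'F_p}).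

Let zeta := m ^+ (p.-1 %/ q).

Lemma mulpX (u : {unit 'F_p}) (k : nat) : mulp u ^+ k = mulp (u ^+ k).
Proof.
have mulpE v : mulp v = aff_at 0%R v 0%R by congr aff; ring.
by rewrite !mulpE aff_at0X.
Qed.

(** The affine maps with linear part in <zeta> form a group containing z and t; conversely each of
    them is some z^k t^b. *)
Lemma mem_Gpq (a : {unit 'F_p}) (b : 'F_p) :
  (aff a b \in Gpq q m) = (a \in <[zeta]>).
Proof.
apply/idP/idP => [Gab|/cycleP[k ->]]; last first.
  have -> : aff (zeta ^+ k) b = zpq q m ^+ k * tr p ^+ b.
    rewrite /zpq !mulpX trX affM mulg1 GRing.mul0r GRing.add0r.
    by congr aff; rewrite Zp_nat valZpK.
  by rewrite groupM // groupX // mem_gen // !inE eqxx ?orbT.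
pose K := [set aff ab.1 ab.2 | ab in setX <[zeta]> [set: 'F_p]].
have KP u c : u \in <[zeta]> -> aff u c \in K.
  by move=> zu; apply/imsetP; exists (u, c) => //; rewrite !inE zu.
have gK : group_set K.
  apply/group_setP; split; first by rewrite -(aff_at1 0%R) KP.
  move=> _ _ /imsetP[[u c] /setXP[/= Ku _] ->]
    /imsetP[[v d] /setXP[/= Kv _] ->].
  by rewrite affM KP ?groupM.
have /subsetP/(_ _ Gab) : Gpq q m \subset Group gK.
  rewrite gen_subG; apply/subsetP=> w /set2P[]->; last exact: KP.
  by rewrite /zpq mulpX KP ?cycle_id.
by case/imsetP=> [[u c] /setXP[/= zu _]] /aff_inj2[->].
Qed.

(** The equation on [c] says that [c] is fixed by x |-> x mu + 1, the generator of [Hl1], which is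
    thus a homothety centred at [c]. *)
Lemma mem_orbit_Hl1 (l : nat) (c : 'F_p) (a : {unit 'F_p}) (b : 'F_p)
    (w : {perm 'F_p}) (mu := m ^+ (p.-1 %/ l)) :
    (c * (1 - val mu) = 1)%R -> a \in <[zeta]> ->
  reflect (exists2 u, u \in <[mu]> & w = aff_at c a (b * val u)%R)
    (w \in orbit 'P (conj_aut (Gpq q m) @* Hl1 m l) (aff_at c a b)).
Proof.
move=> cmu za; have Ga : aff_at c a b \in Gpq q m by rewrite mem_Gpq.
have h_def : mulp m ^+ (p.-1 %/ l) * tr p = aff_at c mu 0%R.
  rewrite mulpX /mulp /tr affM mulg1 GRing.mul0r GRing.add0r.
  by rewrite /aff_at cmu GRing.addr0.
have actE h : h \in Hl1 m l ->
  'P%act (aff_at c a b) (conj_aut (Gpq q m) h) = aff_at c a b ^ h.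
  move=> Hh; rewrite -(norm_conj_autE _ Ga) //.
  exact: subsetP (Hl1_norm q m l) _ Hh.
apply: (iffP imsetP) => [[_ /morphimP[h _ Hh ->] ->]|[u /cycleP[k ->] ->]].
  rewrite actE //; move: Hh; rewrite /= h_def => /cycleP[k ->].
  by exists (mu ^+ k); rewrite ?mem_cycle // aff_at0X aff_atJ.
have Hh : aff_at c mu 0%R ^+ k \in Hl1 m l by rewrite /= h_def mem_cycle.
exists (conj_aut (Gpq q m) (aff_at c mu 0%R ^+ k)).
  by rewrite mem_morphim // (subsetP (Hl1_norm q m l) _ Hh).
by rewrite actE // aff_at0X aff_atJ.
Qed.

End AffineGroup.

(** * The bijection between the two vertex sets and its effect on edges *)

Section Isomorphism.

Variables (p q : nat) (m x : {unit 'F_p}) (y : {unit 'F_q}) (l i : nat).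
Hypotheses (p_prime : prime p) (q_prime : prime q).
Hypotheses (q_dvd : q %| p.-1) (q_dvd_l : q %| l).
Hypothesis m_gen : generator [set: {unit 'F_p}] m.
Hypotheses (l_gt1 : 1 < l) (l_dvd : l %| p.-1) (i_bound : 1 <= i <= q.-1).

Let zeta := m ^+ (p.-1 %/ q).
Let mu := m ^+ (p.-1 %/ l).
Let omega := zeta ^+ i.
Let c : 'F_p := (1 - val mu)^-1%R.
Let lam : 'F_p := (c * (val omega - 1))%R.
(** This is the isomorphism from the additive group Z_q onto <omega>, computed on the representative
    of [k] below q. *)
Let chi (k : 'F_q) := omega ^+ k.

Let order_root n : n %| p.-1 -> #[m ^+ (p.-1 %/ n)] = n.
Proof.
move=> n_dvd; have om : #[m] = p.-1.
  by rewrite /order -(eqP m_gen) card_unit_Fp.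
have p1_gt0 : 0 < p.-1 by rewrite -subn1 subn_gt0 prime_gt1.
by rewrite orderXdiv om ?dvdn_div // divnA // mulKn.
Qed.

Let c_mu : (c * (1 - val mu) = 1)%R.
Proof.
apply: GRing.mulVf; apply: contraTneq l_gt1 => /eqP.
rewrite GRing.subr_eq0 eq_sym => /eqP mu1.
by rewrite -(order_root l_dvd) order_gt1 negbK; apply/eqP/val_inj.
Qed.

Let order_omega : #[omega] = q.
Proof.
apply/prime_nt_dvdP => //; last first.
  by rewrite order_dvdn -expgM mulnC expgM -{1}(order_root q_dvd)
    expg_order expg1n.
have /andP[i_gt0 i_lt] := i_bound.
rewrite order_eq1 -order_dvdn order_root // gtnNdvd //.
by rewrite -(prednK (prime_gt0 q_prime)).
Qed.

Let mem_mu (u : {unit 'F_p}) : (u \in <[mu]>) = (u ^+ l == 1).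
Proof.
by have := mem_cycle_generator_dvd m_gen; rewrite /= card_unit_Fp //; apply;
  rewrite ?inE.
Qed.

(** Here the divisibility of [l] by [q] enters: <mu> consists of all [l]-th roots of unity, hence of
    all [q]-th ones too. *)
Let omega_mu : omega \in <[mu]>.
Proof. by rewrite mem_mu -order_dvdn order_omega. Qed.

Let chiD (j k : 'F_q) : chi (j + k)%R = chi j * chi k.
Proof.
have jk : (j + k)%R = (j + k) %% q :> nat by congr (_ %% _); apply: Fp_cast.
have oq : omega ^+ q = 1 by rewrite -{1}order_omega expg_order.
by rewrite /chi jk expg_mod ?expgD.
Qed.

Let chi_inj : injective chi.
Proof.
move=> j k /eqP; rewrite eq_expg_mod_order order_omega.
have lt (n : 'F_q) : n < q by rewrite -{2}(Fp_cast q_prime) ltn_ord.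
by rewrite !modn_small ?lt // => /eqP/val_inj.
Qed.

Let chi1 : chi 1%R = omega.
Proof. by rewrite /chi /= modn_small ?expg1 // Fp_cast ?prime_gt1. Qed.

Let chiN (k : 'F_q) : chi (- k)%R = (chi k)^-1.
Proof.
by apply: (mulIg (chi k)); rewrite -chiD GRing.addNr mulVg.
Qed.

Let lam_neq0 : lam != 0%R.
Proof.
rewrite GRing.mulf_neq0 //.
  by apply/negP => /eqP c0; move/eqP: c_mu; rewrite c0 GRing.mul0r
    eq_sym GRing.oner_eq0.
rewrite GRing.subr_eq0; apply: contraTneq (prime_gt1 q_prime) => omega1.
by rewrite -order_omega order_gt1 negbK; apply/eqP/val_inj.
Qed.

Let vertex (w : 'F_p * 'F_q) : {perm 'F_p} := aff_at c (chi w.2) (lam * w.1)%R.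

Let vertex_Gpq (w : 'F_p * 'F_q) : vertex w \in Gpq q m.
Proof. by rewrite mem_Gpq groupX //; apply: mem_cycle. Qed.

Let vertex_inj : injective vertex.
Proof.
move=> [b k] [b' k'] /aff_at_inj[/= /chi_inj-> /(GRing.mulfI lam_neq0)->].
by [].
Qed.

(** An upper bound is enough: together with [vertex_inj] it makes [vertex] a bijection onto
    [Gpq]. *)
Let card_Gpq_le : #|Gpq q m| <= p * q.
Proof.
have /subset_leq_card/leq_trans : Gpq q m \subset
    [set aff ab.1 ab.2 | ab in setX <[zeta]> [set: 'F_p]].
  apply/subsetP => g Gg; have /imsetP[[a b] _ gE] :=
    subsetP (Gpq_AGL1 q m) g Gg.
  by apply/imsetP; exists (a, b); rewrite // !inE andbT -(mem_Gpq _ _ _ b) -gE.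
apply; apply: leq_trans (leq_imset_card _ _) _.
by rewrite cardsX cardsT card_Fp // -/(order zeta) order_root // mulnC.
Qed.

(** The twist by the inverse of [chi w.2] is the only trace of noncommutativity, and it lies in
    <mu>. *)
Let vertex_div (w w' : 'F_p * 'F_q) :
  vertex w' * (vertex w)^-1 =
    aff_at c (chi (w'.2 - w.2)%R)
      (lam * ((w'.1 - w.1) * val (chi w.2)^-1%g))%R.
Proof.
rewrite /vertex aff_atV aff_atM chiD chiN; congr aff_at; ring.
Qed.

Let zpqX : zpq q m ^+ i = aff_at c omega lam.
Proof.
rewrite /zpq !mulpX /mulp -/zeta -/omega (affE_at c); congr aff_at.
rewrite /lam; ring.
Qed.

Let zpqXV : (zpq q m ^+ i)^-1 = aff_at c omega^-1 (- lam * val omega^-1%g)%R.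
Proof. by rewrite zpqX aff_atV. Qed.

(** Comparing linear parts forces the second coordinates to differ by 1 or -1, according to the
    orbit; comparing translation parts leaves the first difference, up to sign, in <mu>, which
    absorbs the powers of omega. *)
Let vertex_edge (w w' : 'F_p * 'F_q) :
  reflect (exists2 u, u \in <[mu]> &
             (w'.1 - w.1, w'.2 - w.2)%R = (val u, 1)%R
          \/ (w'.1 - w.1, w'.2 - w.2)%R = (- val u, - 1)%R)
    (vertex w' * (vertex w)^-1 \in
       gamma_set (conj_aut (Gpq q m) @* Hl1 m l) (zpq q m ^+ i)).
Proof.
have chi_mu k : chi k \in <[mu]> by rewrite groupX.
have div_chi k u : u \in <[mu]> -> u * (chi k)^-1 \in <[mu]>.
  by move=> Mu; rewrite groupM // groupV; apply: chi_mu.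
have om_z : omega \in <[zeta]> by rewrite mem_cycle.
rewrite inE zpqXV zpqX vertex_div.
have orb a b v := mem_orbit_Hl1 (a := a) b v c_mu.
apply: (iffP orP) => [[]|[u Mu [E|E]]].
- case/orb => // u Mu /aff_at_inj[]; rewrite -chi1 => /chi_inj->.
  move/(GRing.mulfI lam_neq0) => uE.
  exists (u * chi w.2); first by rewrite groupM.
  by left; rewrite /= -uE FinRing.val_unitV GRing.mulfVK //
    -GRing.unitfE (valP (chi w.2)).
- case/orb; rewrite ?groupV // => u Mu /aff_at_inj[].
  rewrite -chi1 -chiN => /chi_inj->.
  rewrite GRing.mulNr GRing.mulNr -GRing.mulrA -GRing.mulrN.
  move/(GRing.mulfI lam_neq0) => uE.
  (* The factor [chi (-1)] is the inverse of omega in the translation part of z^(-i); the factor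
     [chi w.2] undoes the twist. *)
  exists (chi (-1)%R * u * chi w.2); first by rewrite !groupM.
  right; congr pair.
  rewrite !FinRing.val_unitM -GRing.mulNr -uE FinRing.val_unitV.
  by rewrite GRing.mulfVK // -GRing.unitfE (valP (chi w.2)).
- have /= -> := congr1 fst E; have /= -> := congr1 snd E.
  left; apply/orb => //; exists (u * (chi w.2)^-1); first exact: div_chi.
  by rewrite chi1.
have /= -> := congr1 fst E; have /= -> := congr1 snd E.
right; apply/orb; rewrite ?groupV //; exists (u * (chi w.2)^-1 * omega).
  exact: groupM (div_chi _ _ Mu) omega_mu.
rewrite chiN chi1; congr aff_at; rewrite !FinRing.val_unitM !FinRing.val_unitV.
have o0 : val omega != 0%R by rewrite -GRing.unitfE (valP omega).
move: o0 => /= o0; field.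
by rewrite o0 -GRing.unitfE (valP (chi w.2)).
Qed.

Hypothesis q_odd : odd q.
Hypothesis x_gen : generator [set: {unit 'F_p}] x.
Hypothesis y_gen : generator [set: {unit 'F_q}] y.

Lemma Gamma_pq_iso (D := if odd l then p.-1 %/ (2 * l) else 0) :
  graph_iso (Gamma_pq q m l i) (Gamma_prod x y (q.-1 %/ 2) (p.-1 %/ l) D).
Proof.
have even_pred n : odd n -> ~~ odd n.-1 by case: n.
have p_odd : odd p.
  case: (even_prime p_prime) => // p2; move: q_dvd q_odd q_prime.
  by rewrite p2 dvdn1 => /eqP->.
have oF n : prime n -> #|[set: {unit 'F_n}]| = n.-1 := @card_unit_Fp n.
have yN1 : y ^+ (q.-1 %/ 2) = unitN1 _.
  by rewrite -(oF q) // generator_expg_half // oF // even_pred.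
have xN1 : x ^+ (p.-1 %/ 2) = unitN1 _.
  by rewrite -(oF p) // generator_expg_half // oF // even_pred.
have cyc_x : <[x ^+ (p.-1 %/ l)]> = <[mu]>.
  by apply/setP => u; rewrite mem_mu -(oF p p_prime)
    mem_cycle_generator_dvd ?oF ?inE.
have N1x : unitN1 _ * x ^+ D \in <[mu]>.
  (* For even [l] both -1 and x^0 have [l]-th power 1. For odd [l] that of -1 is -1, and so is that
     of x^D, which is x^((p-1)/2). *)
  have N1l : unitN1 ('F_p) ^+ l = unitN1 _ ^+ odd l.
    by rewrite -(expg_mod _ (unitN1_sqr _)) modn2.
  rewrite mem_mu expgMn; last exact: unit_Zp_mulgC.
  rewrite N1l -expgM /D; case: ifP => l_odd; last by rewrite mul0n !expg0 mulg1.
  (* This makes the division defining [D] exact. *)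
  have l_dvd2 : l %| p.-1 %/ 2.
    rewrite -(Gauss_dvdr _ (_ : coprime l 2)) ?coprimen2 //.
    by rewrite mulnC divnK // dvdn2 even_pred.
  by rewrite divnMA divnK // xN1 -expg2 unitN1_sqr.
apply: graph_iso_sym.
pose f (w : subg_of [set: 'F_p * 'F_q]) := subg (Gpq q m) (vertex (sgval w)).
exists f.
  apply: inj_card_bij => [w w' /(congr1 sgval)|].
    by rewrite !subgK ?vertex_Gpq // => /vertex_inj/val_inj.
  apply: leq_trans (_ : p * q <= _); first by rewrite card_sub.
  by rewrite card_sub cardsT card_prod !card_Fp.
move=> w w'; rewrite /Gamma_pq /Gamma_prod /gamma /cay !subgK ?vertex_Gpq //.
apply/vertex_edge/(mem_gamma_prod _ cyc_x N1x yN1) => //.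
Qed.

End Isomorphism.

Theorem proposition3p13 (p q : nat) (m x : {unit 'F_p}) (y : {unit 'F_q})
    (l i : nat) (p_prime : prime p) (q_prime : prime q) (q_odd : odd q)
    (q_dvd : q %| p.-1)
    (m_gen : generator [set: {unit 'F_p}] m)
    (x_gen : generator [set: {unit 'F_p}] x)
    (y_gen : generator [set: {unit 'F_q}] y)
    (l_gt1 : 1 < l) (l_dvd : l %| p.-1) (i_bound : 1 <= i <= q.-1)
    (q_dvd_l : q %| l) :
  let d := if odd l then p.-1 %/ (2 * l) else 0 in
  graph_iso (Gamma_pq q m l i) (Gamma_prod x y (q.-1 %/ 2) (p.-1 %/ l) d)
  /\ (forall j : nat, 1 <= j <= q.-1 ->
        graph_iso (Gamma_pq q m l i) (Gamma_pq q m l j)).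
Proof.
split=> [|j j_bound]; first exact: Gamma_pq_iso.
(* Both graphs are isomorphic to the same product graph, in which the exponent of z does not
   occur. *)
apply: graph_iso_trans (graph_iso_sym _).
  exact: (Gamma_pq_iso (x := x) (y := y)).
exact: Gamma_pq_iso.
Qed.
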